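(* Let $G$ be a finite simple graph with vertex set $V(G)=\{x_1,\dots,x_n\}$ and let $\mathbb{K}$ be a field. Then $$\operatorname{pdim}\mathbb{K}[\Delta_G]\ \geq\ \operatorname{bight} I(G)\ \geq\ \max_{1\leq i\leq n}\{\deg_G(x_i)\}.$$
   Context: $R=\mathbb{K}[x_1,\dots,x_n]$ is the polynomial ring over $\mathbb{K}$ with variables the vertices of $G$; $I(G)=(x_ix_j\mid \{x_i,x_j\}\in E(G))\subseteq R$ is the edge ideal; $\Delta_G$ is the independence complex of $G$ (the simplicial complex of all independent sets), whose Stanley--Reisner ring is $\mathbb{K}[\Delta_G]=R/I(G)$. $\operatorname{pdim}\mathbb{K}[\Delta_G]$ is the projective dimension of $R/I(G)$ as an $R$-module, i.e. the length of its minimal graded free resolution over $R$. The big height $\operatorname{bight} I(G)$ is the maximum cardinality of a (inclusion-)minimal vertex cover of $G$; equivalently $n$ minus the minimum cardinality of a maximal independent set of $G$. $\deg_G(x)$ is the number of neighbours of $x$ in $G$. *)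

(* Defs.v *)
From HB Require Import structures.
From mathcomp Require Import all_boot all_order all_algebra.
From mathcomp Require Import generic_quotient ring_quotient.
From mathcomp Require Import boolp.
From mathcomp Require Import mpoly.

Set Implicit Arguments.
Unset Strict Implicit.
Unset Printing Implicit Defensive.

Import GRing.Theory.
Local Open Scope ring_scope.
Local Open Scope quotient_scope.

Section ProjectiveDimension.
Variable R : pzRingType.

Definition projective_module (P : lmodType R) : Prop :=
  forall (M N : lmodType R) (f : {linear M -> N}) (g : {linear P -> N}),
    (forall y, exists x, f x = y) ->
    exists h : {linear P -> M}, forall x, f (h x) = g x.

Definition exact_at (A B C : lmodType R)
    (f : {linear A -> B}) (g : {linear B -> C}) : Prop :=
  forall y, g y = 0 <-> exists x, f x = y.

(* An exact sequence 0 -> P_d -> ... -> P_0 -> M -> 0 with every P_i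
   projective, continued by zero modules in degrees > d. *)
Definition has_projective_resolution (M : lmodType R) (d : nat) : Prop :=
  exists (P : nat -> lmodType R)
         (del : forall i, {linear P i.+1 -> P i})
         (eps : {linear P 0%N -> M}),
    [/\ forall i, projective_module (P i),
        forall y, exists x, eps x = y,
        exact_at (del 0%N) eps,
        forall i, exact_at (del i.+1) (del i)
      & forall i, (d < i)%N -> forall x : P i, x = 0].

(* The least length of a projective resolution, [None] standing for infinity.
   Lengths are natural numbers, so the zero module gets [Some 0]. *)
Definition projdim (M : lmodType R) : option nat :=
  match pselect (exists d, asbool (has_projective_resolution M d)) with
  | left ex_d => Some (ex_minn ex_d)
  | right _ => None
  end.

End ProjectiveDimension.

Definition leq_enat (b : nat) (d : option nat) : bool :=
  if d is Some m then (b <= m)%N else true.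

Section IdealQuotient.
Variables (R : comNzRingType) (S : R -> Prop).

Definition ideal_gen : {pred R} := fun p =>
  asbool (exists (m : nat) (a g : 'I_m -> R),
            (forall i, S (g i)) /\ p = \sum_(i < m) a i * g i).

Lemma ideal_genM a p : p \in ideal_gen -> a * p \in ideal_gen.
Proof.
move=> /asboolP[m [b [g [Sg ->]]]]; apply/asboolP.
exists m, (fun i => a * b i), g; split=> //.
by rewrite mulr_sumr; apply: eq_bigr => i _; rewrite mulrA.
Qed.

Lemma ideal_gen_zmod_closed : zmod_closed ideal_gen.
Proof.
split=> [|p q].
  apply/asboolP; exists 0%N, (fun=> 0), (fun=> 0); rewrite big_ord0.
  by split=> // -[].
move=> /asboolP[m [a [g [Sg ->]]]] /asboolP[k [b [h [Sh ->]]]].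
apply/asboolP; exists (m + k)%N.
exists (fun i => match split i with inl j => a j | inr j => - b j end).
exists (fun i => match split i with inl j => g j | inr j => h j end).
split=> [i|]; first by case: split.
rewrite big_split_ord -sumrN; congr (_ + _); apply: eq_bigr => i _.
  by rewrite (unsplitK (inl i)).
by rewrite (unsplitK (inr i)) mulNr.
Qed.

HB.instance Definition _ :=
  GRing.isZmodClosed.Build R ideal_gen ideal_gen_zmod_closed.

Definition ideal_quotient : Type := {ideal_quot ideal_gen}.

HB.instance Definition _ := GRing.Zmodule.on ideal_quotient.

Definition ideal_quotient_scale (a : R) (x : ideal_quotient) : ideal_quotient :=
  \pi_{ideal_quot ideal_gen} (a * repr (x : {ideal_quot ideal_gen})).

Lemma ideal_quotient_scaleE a p :
  ideal_quotient_scale a (\pi_{ideal_quot ideal_gen} p) =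
  \pi_{ideal_quot ideal_gen} (a * p).
Proof.
apply/eqP; rewrite -Quotient.idealrBE -mulrBr.
by apply: ideal_genM; rewrite Quotient.idealrBE reprK.
Qed.

Lemma ideal_quotient_scaleA a b x :
  ideal_quotient_scale a (ideal_quotient_scale b x) =
  ideal_quotient_scale (a * b) x.
Proof. by rewrite ideal_quotient_scaleE mulrA. Qed.

Lemma ideal_quotient_scale1 : left_id 1 ideal_quotient_scale.
Proof. by move=> x; rewrite /ideal_quotient_scale mul1r reprK. Qed.

Lemma ideal_quotient_scaleDr : right_distributive ideal_quotient_scale +%R.
Proof.
move=> a x y; rewrite -[x](@reprK _ {ideal_quot ideal_gen}).
rewrite -[y](@reprK _ {ideal_quot ideal_gen}) -[LHS]/(ideal_quotient_scale a
  (\pi_{ideal_quot ideal_gen} _ + \pi_{ideal_quot ideal_gen} _)).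
by rewrite -raddfD !ideal_quotient_scaleE mulrDr raddfD.
Qed.

Lemma ideal_quotient_scaleDl x :
  {morph ideal_quotient_scale^~ x : a b / a + b}.
Proof.
by move=> a b; rewrite /ideal_quotient_scale mulrDl raddfD.
Qed.

HB.instance Definition _ := GRing.Zmodule_isLmodule.Build R ideal_quotient
  ideal_quotient_scaleA ideal_quotient_scale1
  ideal_quotient_scaleDr ideal_quotient_scaleDl.

End IdealQuotient.

(* A graph on {0, ..., n-1} is given by its adjacency relation e. *)
Section Graph.
Variables (n : nat) (e : rel 'I_n).

Definition edge_gen (K : fieldType) (p : {mpoly K[n]}) : Prop :=
  exists i j : 'I_n, e i j /\ p = 'X_i * 'X_j.

(* K[Delta_G] = R/I(G), seen as an R-module. *)
Definition stanley_reisner (K : fieldType) : lmodType {mpoly K[n]} :=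
  ideal_quotient (@edge_gen K).

Definition vertex_cover (W : {set 'I_n}) : bool :=
  [forall i, forall j, e i j ==> (i \in W) || (j \in W)].

Definition bight : nat := \max_(W : {set 'I_n} | minset vertex_cover W) #|W|.

Definition deg (i : 'I_n) : nat := #|[set j | e i j]|.

End Graph.

(* Main.v *)
From HB Require Import structures.
From mathcomp Require Import mpoly freeg.
Require Import Defs.
From mathcomp Require Import all_boot all_order all_algebra.
From mathcomp Require Import generic_quotient ring_quotient boolp.

Set Implicit Arguments.
Unset Strict Implicit.
Unset Printing Implicit Defensive.

Import GRing.Theory.
Local Open Scope ring_scope.
Local Open Scope quotient_scope.

(** Let W be a minimal vertex cover. Every i in W has a neighbour outside W,
    for otherwise W minus i would still cover. Hence the product u of the
    variables outside W satisfies 'X_i * u \in I(G) for every i in W, whereas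
    u itself is not in I(G): setting the variables of W to zero kills every
    edge monomial and fixes u. So the class of u is a nonzero element of
    R/I(G) annihilated by the #|W| variables of W
    ([stanley_reisner_socle]).

    The algebraic half is that a module with a nonzero element m killed by a
    regular sequence s_0, ..., s_(h-1) of R has projective dimension at least
    h. Conceptually m lies in the top Koszul homology of M, which is
    Tor_h(R/(s), M). The proof below unrolls this inside an arbitrary
    resolution P, without Koszul complexes, tensor products or localization.
    Two facts are used: the sequence is weakly regular on projective modules,
    as these are summands of free ones ([weakly_regular_projective]), and
    consequently P/(s_0, ..., s_(k-1))P is exact in degrees > k
    ([exact_mod_prefix]). Then m is lifted step by step: a lift p of m to P_0
    has s_0 p = del p' for some p' in P_1; modulo s_0 the class of p' is again
    a nonzero element killed by s_1, ..., s_(h-1), now in the cokernel of the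
    next differential, and so on. If the resolution had length d < h, the d-th
    such lift would be an element of P_d outside (s_0, ..., s_(d-1))P_d but
    carried into it by s_d, against regularity ([socle_eq0]).

    For the degree bound, the complement of a vertex i is a vertex cover; a
    minimal cover inside it omits i and must therefore contain all neighbours
    of i. *)

(** * Weakly regular sequences on modules *)

Section WeaklyRegular.
Variables (R : comNzRingType) (s : seq R).

(** Membership in the submodule (s_0, ..., s_(k-1))M. Stating everything
    through this predicate keeps all computations inside M, so that no
    quotient module M/(s_0, ..., s_(k-1))M has to be formed. *)
Definition prefix_smul (k : nat) (M : lmodType R) (z : M) : Prop :=
  exists w : nat -> M, z = \sum_(a < k) s`_a *: w a.

(** Each s_k is a nonzerodivisor on M/(s_0, ..., s_(k-1))M; weakly, because
    that quotient is allowed to vanish. *)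
Definition weakly_regular (M : lmodType R) : Prop :=
  forall k (w : M), (k < size s)%N ->
    prefix_smul k (s`_k *: w) -> prefix_smul k w.

Lemma prefix_smul0 k (M : lmodType R) : prefix_smul k (0 : M).
Proof. by exists (fun=> 0); rewrite big1 // => a _; rewrite scaler0. Qed.

Lemma prefix_smulD k (M : lmodType R) (y z : M) :
  prefix_smul k y -> prefix_smul k z -> prefix_smul k (y + z).
Proof.
move=> [v ->] [w ->]; exists (fun a => v a + w a).
by rewrite -big_split; apply: eq_bigr => a _; rewrite scalerDr.
Qed.

Lemma prefix_smulZ k (M : lmodType R) c (z : M) :
  prefix_smul k z -> prefix_smul k (c *: z).
Proof.
move=> [w ->]; exists (fun a => c *: w a).
by rewrite scaler_sumr; apply: eq_bigr => a _; rewrite !scalerA mulrC.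
Qed.

Lemma prefix_smulB k (M : lmodType R) (y z : M) :
  prefix_smul k y -> prefix_smul k z -> prefix_smul k (y - z).
Proof.
move=> Jy Jz; apply: prefix_smulD => //.
by rewrite -scaleN1r; apply: prefix_smulZ.
Qed.

Lemma prefix_smul_linear k (M N : lmodType R) (f : {linear M -> N}) z :
  prefix_smul k z -> prefix_smul k (f z).
Proof.
move=> [w ->]; exists (fun a => f (w a)).
by rewrite linear_sum; apply: eq_bigr => a _; rewrite linearZ.
Qed.

Lemma prefix_smul_nth k a (M : lmodType R) (w : M) :
  (a < k)%N -> prefix_smul k (s`_a *: w).
Proof.
move=> lt_ak; exists (fun b => if b == a then w else 0).
rewrite (bigD1 (Ordinal lt_ak)) //= eqxx big1 ?addr0 // => b.
by rewrite -val_eqE /= => /negPf->; rewrite scaler0.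
Qed.

(** The inductive description of the chain of submodules: this is what lets
    arguments pass from one prefix of the sequence to the next. *)
Lemma prefix_smulS k (M : lmodType R) (z : M) :
  prefix_smul k.+1 z <-> exists w, prefix_smul k (z - s`_k *: w).
Proof.
split=> [[w ->]|[w [v Ez]]].
  by exists (w k); rewrite big_ord_recr /= addrK; exists w.
exists (fun a => if a == k then w else v a).
rewrite big_ord_recr /= eqxx -[z](subrK (s`_k *: w)) Ez; congr (_ + _).
by apply: eq_bigr => a _; rewrite (ltn_eqF (ltn_ord a)).
Qed.

(** * Projective modules inherit weak regularity from the ring *)

(** In a free module, membership in (s_0, ..., s_(k-1))F is tested on each
    coefficient, the supports being finite. *)
Lemma weakly_regular_free (I : choiceType) :
  weakly_regular R^o -> weakly_regular {freeg I / R}.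
Proof.
have coefP k (D : {freeg I / R}) :
    prefix_smul k D <-> forall z, prefix_smul k (coeff z D : R^o).
  split=> [[w ->] z|cD].
    exists (fun a => coeff z (w a)).
    by rewrite raddf_sum; apply: eq_bigr => a _; rewrite /= coeffZ.
  have [g Eg] := choice cD.
  exists (fun a => \sum_(z <- dom D) << g z a *g z >>).
  rewrite -[LHS]freeg_sumE.
  transitivity (\sum_(z <- dom D) \sum_(a < k) s`_a *: << g z a *g z >>
                 : {freeg I / R}).
    apply: eq_bigr => z _; apply/eqP/freeg_eqP => y.
    rewrite raddf_sum coeffU Eg mulr_suml; apply: eq_bigr => a _.
    by rewrite /= coeffZ coeffU mulrA.
  by rewrite exchange_big; apply: eq_bigr => a _; rewrite scaler_sumr.
move=> regR k D lt_k /coefP JD; apply/coefP => z.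
by apply: regR => //; have := JD z; rewrite coeffZ.
Qed.

Section Lift.
Variable P : lmodType R.

(** The free module on all elements of P serves as a free cover of P. *)
Definition freeg_eval (D : {freeg P / R}) : P := fglift (idfun : P -> P) D.

HB.instance Definition _ := GRing.isZmodMorphism.Build {freeg P / R} P
  freeg_eval (lift_is_additive idfun).

Lemma freeg_eval_is_scalable : scalable freeg_eval.
Proof.
move=> c D; have -> : c *: D = \sum_(z <- dom D) << c * coeff z D *g z >> by [].
rewrite -[in RHS](freeg_sumE D) !raddf_sum; apply: eq_bigr => z _.
by rewrite /= /freeg_eval !liftU scalerA.
Qed.

HB.instance Definition _ :=
  GRing.isScalable.Build R {freeg P / R} P _ freeg_eval freeg_eval_is_scalable.

(** A splitting h of the free cover carries the hypothesis into a free module,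
    and the cover carries the conclusion back. *)
Lemma weakly_regular_projective :
  weakly_regular R^o -> projective_module P -> weakly_regular P.
Proof.
move=> /(@weakly_regular_free P) regF projP k w lt_k Jw.
have evalU (y : P) : exists D, freeg_eval D = y.
  by exists << y >>; rewrite /freeg_eval liftU scale1r.
have [h hK] := projP _ _ freeg_eval (idfun : {linear P -> P}) evalU.
rewrite -[w]hK; apply: prefix_smul_linear; apply: regF lt_k _.
by rewrite -linearZ; apply: prefix_smul_linear.
Qed.

End Lift.

(** * Socle elements and the length of a resolution *)

Section Resolution.
Variables (M : lmodType R) (P : nat -> lmodType R).
Variables (del : forall i, {linear P i.+1 -> P i}) (eps : {linear P 0%N -> M}).
Hypotheses (eps_surj : forall y, exists x, eps x = y).
Hypotheses (ex0 : exact_at (del 0%N) eps).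
Hypotheses (exS : forall i, exact_at (del i.+1) (del i)).
Hypothesis regP : forall i, weakly_regular (P i).

(** Vanishing of the class of z in the cokernel of del k reduced modulo
    (s_0, ..., s_(k-1)). *)
Definition boundary_mod k (z : P k) : Prop :=
  exists v, prefix_smul k (z - del k v).

(** When s is a regular sequence on R and P is a projective resolution of M,
    this is the vanishing of Tor_(i+1)(R/(s_0, ..., s_(k-1)), M) for i >= k.
    Each new s_k costs one degree: if del z = s_k w modulo the earlier terms,
    then s_k del w vanishes there, so w is a cycle by regularity, hence a
    boundary del v by exactness one degree lower, and z - s_k v is a cycle
    modulo the earlier terms, to which the induction applies. *)
Lemma exact_mod_prefix k i (z : P i.+1) : (k <= size s)%N -> (k <= i)%N ->
  prefix_smul k (del i z) -> exists v, prefix_smul k (z - del i.+1 v).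
Proof.
elim: k i z => [|k IHk] i z le_ks le_ki.
  move=> [w]; rewrite big_ord0 => /exS[v <-]; exists v.
  by rewrite subrr; apply: prefix_smul0.
case: i z le_ki => // i z le_ki /prefix_smulS[w Jw].
have [|v Jv] := IHk i w (ltnW le_ks) le_ki.
  apply: regP => //; rewrite -linearZ /=.
  have := prefix_smul_linear (del i) Jw.
  rewrite linearB /= (_ : del i (del i.+1 z) = 0); last by apply/exS; exists z.
  by rewrite sub0r => /(prefix_smulZ (-1)); rewrite scaleN1r opprK.
have [|t Jt] := IHk i.+1 (z - s`_k *: v) (ltnW le_ks) (leqW le_ki).
  rewrite linearB linearZ /=.
  have := prefix_smulD Jw (prefix_smulZ s`_k Jv).
  by rewrite scalerBr addrA subrK.
exists t; apply/prefix_smulS; exists v.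
by rewrite addrAC.
Qed.

(** Dimension shifting for an element m killed by the sequence: as long as
    k <= size s, degree k contains an element which is nonzero in the reduced
    cokernel of del k and is killed there by s_k, s_(k+1), ... For k = d this
    contradicts regularity, since P_(d+1) = 0. *)
Lemma socle_eq0 d (m : M) : (forall i, (d < i)%N -> forall x : P i, x = 0) ->
  (d < size s)%N -> (forall j, (j < size s)%N -> s`_j *: m = 0) -> m = 0.
Proof.
move=> P0 lt_ds sm0; apply: contrapT => m_neq0.
have climb k : (k <= size s)%N -> exists p : P k,
    (forall j, (k <= j < size s)%N -> boundary_mod (s`_j *: p)) /\
    ~ boundary_mod p.
  elim: k => [_|k IHk lt_ks].
    have [p Ep] := eps_surj m; exists p; split=> [j lt_js|[v [w]]].
      have [v Ev] : exists v, del 0%N v = s`_j *: p.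
        by apply/ex0; rewrite linearZ /= Ep sm0.
      by exists v; rewrite Ev subrr; apply: prefix_smul0.
    rewrite big_ord0 => /subr0_eq Ev; apply: m_neq0; rewrite -Ep.
    by apply/ex0; exists v.
  have [p [sp np]] := IHk (ltnW lt_ks).
  have [|v Jv] := sp k; first by rewrite leqnn.
  exists v; split=> [j /andP[lt_kj lt_js]|[t /prefix_smulS[w Jw]]].
    have [|u Ju] := sp j; first by rewrite (ltnW lt_kj).
      (* s_j p and s_k p are boundaries of u and v, so the syzygy
       s_j v - s_k u is a cycle modulo the first k terms. *)
  have [||t Jt] := @exact_mod_prefix k k (s`_j *: v - s`_k *: u) (ltnW lt_ks).
    - by [].
    - rewrite linearB !linearZ /=.
      have := prefix_smulB (prefix_smulZ s`_k Ju) (prefix_smulZ s`_j Jv).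
      rewrite !scalerBr !scalerA [s`_k * s`_j]mulrC opprB.
      by rewrite addrC addrA subrK scalerN.
    exists t; apply/prefix_smulS; exists u.
    by rewrite addrAC.
  (* Applying del k to v = del t + s_k w + ... gives s_k p = s_k (del w)
     modulo the first k terms, and s_k can be cancelled. *)
  apply: np; exists w; apply: regP => //.
  have := prefix_smulD Jv (prefix_smul_linear (del k) Jw).
  have -> : del k (v - del k.+1 t - s`_k *: w) = del k v - s`_k *: del k w.
    rewrite !linearB linearZ /= (_ : del k (del k.+1 t) = 0) ?subr0 //.
    by apply/exS; exists t.
  by rewrite addrA subrK -scalerBr.
have [p [sp np]] := climb d (ltnW lt_ds).
have [|v] := sp d; first by rewrite leqnn.
rewrite (P0 _ _ v) // linear0 subr0 => /(regP lt_ds) Jp.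
by apply: np; exists 0; rewrite linear0 subr0.
Qed.

End Resolution.

Lemma socle_le_resolution (M : lmodType R) d (m : M) :
  weakly_regular R^o -> (forall j, (j < size s)%N -> s`_j *: m = 0) -> m <> 0 ->
  has_projective_resolution M d -> (size s <= d)%N.
Proof.
move=> regR sm0 m_neq0 [P [del [eps [projP surj ex0 exS P0]]]].
rewrite leqNgt; apply/negP => lt_ds; apply: m_neq0.
apply: (socle_eq0 surj ex0 exS) P0 lt_ds sm0 => i.
exact: weakly_regular_projective.
Qed.

End WeaklyRegular.

(** * Sequences of distinct variables *)

Section KillVariables.
Variables (K : fieldType) (n : nat).
Implicit Types (A : {pred 'I_n}) (p : {mpoly K[n]}).

Lemma var_neq0 i : 'X_i != 0 :> {mpoly K[n]}.
Proof.
apply/eqP => /(congr1 (mcoeff U_(i))); rewrite mcoeffX mcoeff0 eqxx => /eqP.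
by rewrite oner_eq0.
Qed.

(** The substitution sending the variables in A to zero detects the ideal that
    they generate, and makes it visibly prime. *)
Definition kill A : {mpoly K[n]} -> {mpoly K[n]} :=
  comp_mpoly [tuple (if i \in A then 0 else 'X_i) | i < n].

HB.instance Definition _ A := GRing.RMorphism.on (kill A).

Lemma killX A i : kill A 'X_i = if i \in A then 0 else 'X_i.
Proof. by rewrite /kill comp_mpolyXU -tnth_nth tnth_mktuple. Qed.

(** The kernel of [kill] is generated by the killed variables because
    p - kill A p lies in the ideal they generate: this holds for constants and
    variables and is stable under sums and products. *)
Lemma prefix_smul_vars (u : seq 'I_n) k p :
  prefix_smul [seq 'X_i | i <- u] k (p : {mpoly K[n]}^o) <->
  kill (mem (take k u)) p = 0.
Proof.
split=> [[w ->]|kp0].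
  rewrite rmorph_sum big1 // => a _; rewrite rmorphM; move: (w a) => q.
  have [lt_au|le_ua] := ltnP a (size u); last first.
    by rewrite nth_default ?size_map // rmorph0 mul0r.
  case: u lt_au => // i0 u lt_au; rewrite (nth_map i0) // [X in X * _]killX.
  rewrite ifT ?mul0r // -(nth_take i0 (ltn_ord a)).
  apply: mem_nth.
  by rewrite size_take_min leq_min ltn_ord.
rewrite -[p]subr0 -kp0; move: p {kp0}.
set phi := kill _.
pose J := @prefix_smul _ [seq 'X_i | i <- u] k {mpoly K[n]}^o.
rewrite -/(J _).
have JM p q : J (p - phi p) -> J (q - phi q) -> J (p * q - phi (p * q)).
  move=> Jp Jq; rewrite [phi _]rmorphM -/phi /=.
  have -> : p * q - phi p * phi q = q * (p - phi p) + phi p * (q - phi q).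
    by rewrite !mulrBr addrA [q * p]mulrC [q * phi p]mulrC subrK.
  by apply: prefix_smulD; apply: prefix_smulZ.
have J1 : J (1 - phi 1) by rewrite [phi 1]rmorph1 subrr; apply: prefix_smul0.
have JX i : J ('X_i - phi 'X_i).
  rewrite /phi killX; case: ifP => [|_].
  2: by rewrite subrr; apply: prefix_smul0.
  rewrite subr0 => iu.
  have lt_iu : (index i u < size u)%N by rewrite index_mem (mem_take iu).
  have -> : 'X_i = [seq 'X_i | i <- u]`_(index i u) *: (1 : {mpoly K[n]}^o).
    by rewrite (nth_map i) // nth_index -?index_mem // [RHS]mulr1.
  by apply: prefix_smul_nth; rewrite -(in_take k (mem_take iu)).
move=> p; rewrite {1 2}[p]mpolyE [phi _]rmorph_sum -sumrB.
apply: big_ind => [|y z|m _]; [exact: prefix_smul0|exact: prefix_smulD|].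
rewrite -mul_mpolyC -/(J _); apply: (JM).
  have -> : phi (p@_m)%:MP = (p@_m)%:MP by apply: comp_mpolyC.
  by rewrite subrr; apply: prefix_smul0.
rewrite mpolyXE_id.
apply: (@big_ind _ (fun q => J (q - phi q)) _ _ J1 JM) => i _.
by elim: (m i) => [|j IHj]; rewrite ?expr0 ?exprS //; apply: JM.
Qed.

(** The substitution killing the first k variables fixes the next one, which
    is a nonzerodivisor in its image. *)
Lemma weakly_regular_vars (u : seq 'I_n) : uniq u ->
  weakly_regular [seq 'X_i | i <- u] {mpoly K[n]}^o.
Proof.
move=> uniq_u k p; rewrite size_map => lt_ku /prefix_smul_vars kp0.
apply/prefix_smul_vars; apply/eqP; move/eqP: kp0.
case: u uniq_u lt_ku => // i0 u uniq_u lt_ku.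
rewrite (nth_map i0) // rmorphM mulf_eq0 [X in X == 0]killX.
rewrite ifF ?(negPf (var_neq0 _)) //.
apply/negP => /(nthP i0)[j]; rewrite size_take lt_ku => lt_jk.
rewrite nth_take // => /eqP; rewrite nth_uniq ?(ltn_trans lt_jk) //.
by rewrite ltn_eqF.
Qed.

End KillVariables.

(** * Minimal vertex covers *)

Section Covers.
Variables (n : nat) (e : rel 'I_n).
Hypotheses (e_sym : symmetric e) (e_irr : irreflexive e).

Lemma vertex_coverP (W : {set 'I_n}) :
  reflect (forall i j, e i j -> (i \in W) || (j \in W)) (vertex_cover e W).
Proof.
apply: (iffP 'forall_forallP) => cW i j; first exact/implyP/cW.
exact/implyP/cW.
Qed.

(** Otherwise all edges at i would be covered by their other end, and i could
    be removed from W. *)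
Lemma minset_cover_neighbor (W : {set 'I_n}) i :
  minset (vertex_cover e) W -> i \in W -> exists2 j, j \notin W & e i j.
Proof.
case/minsetP => cW minW iW; apply: contrapT => noj.
suff /minW EW : vertex_cover e (W :\ i).
  by move: iW; rewrite -EW ?subsetDl // !inE eqxx.
have nbW j : e i j -> (j \in W) && (j != i).
  move=> eij; apply/andP; split; last first.
    by apply: contraTneq eij => ->; rewrite e_irr.
  by apply/negPn/negP => jW; apply: noj; exists j.
apply/vertex_coverP => a b eab; rewrite !inE.
have [Ea|_] /= := eqVneq a i; first by rewrite andbC nbW // -Ea.
have [Eb|_] /= := eqVneq b i; last exact: vertex_coverP eab.
by have := nbW a; rewrite e_sym -Eb => /(_ eab) /andP[->].
Qed.

Lemma deg_le_bight i : (deg e i <= bight e)%N.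
Proof.
have cov : vertex_cover e [set~ i].
  apply/vertex_coverP => a b eab; rewrite !inE -negb_and.
  by apply: contraTN eab => /andP[/eqP-> /eqP->]; rewrite e_irr.
have [W minW sW] := minset_exists cov.
apply: leq_trans (leq_bigmax_cond _ minW); apply: subset_leq_card.
apply/subsetP => j; rewrite inE => /(vertex_coverP _ (minsetp minW) i j).
by case/orP => // /(subsetP sW); rewrite !inE eqxx.
Qed.

(** The witness is the class of the product of all variables outside W; its
    annihilator is the prime ideal generated by the variables of W. *)
Lemma stanley_reisner_socle (K : fieldType) (W : {set 'I_n}) :
  minset (vertex_cover e) W -> exists2 m : stanley_reisner e K,
    m <> 0 & forall i, i \in W -> ('X_i : {mpoly K[n]}) *: m = 0.
Proof.
move=> minW; set I := @edge_gen n e K.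
pose pi p := \pi_{ideal_quot (ideal_gen I)} p.
have piE p : pi p = 0 <-> p \in ideal_gen I.
  have <- : pi 0 = 0 by apply: raddf0.
  rewrite -[p in p \in _]subr0 Quotient.idealrBE.
  by split=> [/eqP|/eqP].
exists (pi (\prod_(j | j \notin W) 'X_j)) => [|i iW].
  move/piE/asboolP => [r [a [g [Ig Eu]]]].
  have /eqP := congr1 (kill (mem W)) Eu.
  rewrite rmorph_prod rmorph_sum [X in _ == X]big1 => [|c _]; last first.
    have [b [b' [ebb' ->]]] := Ig c; rewrite !rmorphM /= !killX.
    by have /vertex_coverP/(_ _ _ ebb')/orP[] := minsetp minW => ->;
      rewrite ?(mul0r, mulr0).
  apply/negP/prodf_neq0 => j jW.
  by rewrite /= killX (negPf jW) var_neq0.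
have [j jW eij] := minset_cover_neighbor minW iW.
rewrite [LHS]ideal_quotient_scaleE; apply/piE.
rewrite (bigD1 j) //= mulrA mulrC; apply: ideal_genM; apply/asboolP.
exists 1%N, (fun=> 1), (fun=> 'X_i * 'X_j); rewrite big_ord1 mul1r.
by split=> // _; exists i, j.
Qed.

End Covers.

Theorem theorem4p11 (K : fieldType) (n : nat) (e : rel 'I_n)
  (e_sym : symmetric e) (e_irr : irreflexive e) :
  leq_enat (bight e) (projdim (stanley_reisner e K)) /\
  (\max_(i < n) deg e i <= bight e)%N.
Proof.
split; last by apply/bigmax_leqP => i _; apply: deg_le_bight.
rewrite /projdim; case: pselect => //= ex_d.
case: ex_minnP => d /asboolP resd _; apply/bigmax_leqP => W minW.
have [m m_neq0 Wm0] := stanley_reisner_socle e_sym e_irr K minW.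
pose s : seq {mpoly K[n]} := [seq 'X_i | i <- enum W].
rewrite cardE -(size_map (fun i => 'X_i : {mpoly K[n]})).
apply: socle_le_resolution m_neq0 resd.
  exact: weakly_regular_vars (enum_uniq _).
move=> j; rewrite size_map => lt_jW.
have i0 : 'I_n by case: (enum W) lt_jW.
rewrite (nth_map i0) //; apply: Wm0.
by rewrite -mem_enum mem_nth.
Qed.
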